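(* Let $d\ge1$ be an integer. Let $\mathfrak{G}_d$ be the set of non-empty partitions $\pi=(\pi_1,\ldots,\pi_r)$ such that (i) $\pi_i\equiv 1$ or $d+2\pmod{2d+1}$ for all $i=1,\ldots,r$; and (ii) $\pi_i-\pi_{i+1}\le 2d+1$ for all $i=1,\ldots,r$, where $\pi_{r+1}:=0$, with strict inequality $\pi_i-\pi_{i+1}<2d+1$ whenever $\pi_i\equiv1\pmod{2d+1}$. Then, as formal power series, $$\sum_{\pi\in\mathfrak{G}_d}x^{\pi_1}y^{\ell(\pi)}q^{\Gamma(\pi)}=\frac{xyq(1-yq+x^{d+1}q^{d+1})}{1-2yq+y^2q^2-x^{2d+1}yq^{2d+2}}.$$ Moreover, for all $n\ge1$, $h_d(n)=f_d(n)=g_d(n)$, where $h_d(n)$ is the number of partitions $\pi$ with $\Gamma(\pi)=n$ whose parts pairwise differ by at least $d$, $f_d(n)$ is the number of partitions $\pi$ with $\Gamma(\pi)=n$ all of whose parts are $\equiv1\pmod{d+1}$, and $g_d(n)$ is the number of $\pi\in\mathfrak{G}_d$ with $\Gamma(\pi)=n$.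
   Context: For a non-empty partition $\pi=(\pi_1\ge\cdots\ge\pi_r\ge1)$, $\ell(\pi)=r$ and $\Gamma(\pi)=\pi_1+\ell(\pi)-1$ (length of the largest hook). *)

(* Defs.v *)
From HB Require Import structures.
From mathcomp Require Import all_boot all_order all_algebra.
From mathcomp Require Import finmap.
From mathcomp Require Import all_classical.

Set Implicit Arguments.
Unset Strict Implicit.
Unset Printing Implicit Defensive.

Import GRing.Theory.

Local Open Scope classical_set_scope.
Local Open Scope ring_scope.

(** * Univariate formal power series *)

Record fps (R : Type) := Fps { fps_coef : nat -> R }.

HB.instance Definition _ (R : Type) := gen_eqMixin (fps R).
HB.instance Definition _ (R : Type) := gen_choiceMixin (fps R).

Lemma fpsP (R : Type) (f g : fps R) : fps_coef f =1 fps_coef g -> f = g.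
Proof. by case: f g => [f] [g] /= /funext ->. Qed.

Section FpsRing.
Variable R : comNzRingType.
Implicit Types f g h : fps R.

Definition fpsC (c : R) : fps R := Fps (fun n => if n is 0%N then c else 0).
Definition fpsX : fps R := Fps (fun n => (n == 1%N)%:R).

Definition fps_add f g := Fps (fun n => fps_coef f n + fps_coef g n).
Definition fps_opp f := Fps (fun n => - fps_coef f n).
Definition fps_mul f g :=
  Fps (fun n => \sum_(i < n.+1) fps_coef f i * fps_coef g (n - i)%N).

Fact fps_addA : associative fps_add.
Proof. by move=> f g h; apply: fpsP => n /=; rewrite addrA. Qed.
Fact fps_addC : commutative fps_add.
Proof. by move=> f g; apply: fpsP => n /=; rewrite addrC. Qed.
Fact fps_add0 : left_id (fpsC 0) fps_add.
Proof. by move=> f; apply: fpsP => -[|n] /=; rewrite add0r. Qed.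
Fact fps_addN : left_inverse (fpsC 0) fps_opp fps_add.
Proof. by move=> f; apply: fpsP => -[|n] /=; rewrite addNr. Qed.

HB.instance Definition _ :=
  GRing.isZmodule.Build (fps R) fps_addA fps_addC fps_add0 fps_addN.

Definition fps_trunc m f : {poly R} := \poly_(i < m) fps_coef f i.

Lemma fps_mul_trunc m f g n : (n < m)%N ->
  fps_coef (fps_mul f g) n = (fps_trunc m f * fps_trunc m g)`_n.
Proof.
move=> nm; rewrite coefM; apply: eq_bigr => i _.
rewrite !coef_poly (leq_ltn_trans (leq_subr _ _) nm).
by rewrite (leq_ltn_trans _ nm) // -ltnS.
Qed.

Fact fps_mulC : commutative fps_mul.
Proof.
by move=> f g; apply: fpsP => n; rewrite !(@fps_mul_trunc n.+1) // mulrC.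
Qed.

Fact fps_mulA : associative fps_mul.
Proof.
move=> f g h; apply: fpsP => n.
have E u v w : fps_coef (fps_mul u (fps_mul v w)) n =
    (fps_trunc n.+1 u * (fps_trunc n.+1 v * fps_trunc n.+1 w))`_n.
  rewrite coefM; apply: eq_bigr => i _.
  by rewrite coef_poly ltn_ord (@fps_mul_trunc n.+1) // ltnS leq_subr.
by rewrite (fps_mulC (fps_mul f g) h) !E mulrA mulrC.
Qed.

Fact fps_mul1 : left_id (fpsC 1) fps_mul.
Proof.
move=> f; apply: fpsP => n /=.
by rewrite big_ord_recl big1 /= => [|i _]; rewrite ?mul0r // mul1r subn0 addr0.
Qed.

Fact fps_mulDl : left_distributive fps_mul fps_add.
Proof.
move=> f g h; apply: fpsP => n /=; rewrite -big_split.
by apply: eq_bigr => i _; rewrite mulrDl.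
Qed.

Fact fps_1neq0 : fpsC 1 != 0.
Proof.
by apply/eqP => /(congr1 (fun f => fps_coef f 0)) /eqP; rewrite /= oner_eq0.
Qed.

HB.instance Definition _ := GRing.Zmodule_isComNzRing.Build (fps R)
  fps_mulA fps_mulC fps_mul1 fps_mulDl fps_1neq0.

Lemma fps_coefM0 f g : fps_coef (f * g) 0 = fps_coef f 0 * fps_coef g 0.
Proof. by rewrite /= big_ord_recl big_ord0 addr0. Qed.

Lemma fps_coef_sum I (r : seq I) (F : I -> fps R) n :
  fps_coef (\sum_(i <- r) F i) n = \sum_(i <- r) fps_coef (F i) n.
Proof.
by elim: r => [|i r IH]; rewrite ?big_nil ?big_cons -?IH //; case: n.
Qed.

Lemma fps_coefX_lt f k n :
  fps_coef f 0 = 0 -> (n < k)%N -> fps_coef (f ^+ k) n = 0.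
Proof.
move=> f0; elim: k n => // k IH n nk; rewrite exprS /= big1 // => -[[|i] /= lti] _.
  by rewrite f0 mul0r.
rewrite IH ?mulr0 // (@leq_trans n) // ltn_subrL.
by rewrite /=; case: n lti {nk}.
Qed.

Lemma fps_coef_geom f i j n : fps_coef f 0 = 0 -> (j <= i <= n)%N ->
  fps_coef (\sum_(k < i.+1) f ^+ k) j = fps_coef (\sum_(k < n.+1) f ^+ k) j.
Proof.
move=> f0 /andP[ji le_in]; rewrite !fps_coef_sum.
rewrite -!(big_mkord xpredT (fun k => fps_coef (f ^+ k) j)).
rewrite [RHS](@big_cat_nat _ _ _ i.+1) //= [X in _ = _ + X]big_nat.
rewrite [X in _ = _ + X]big1 ?addr0 // => k /andP[ik _].
by apply: fps_coefX_lt => //; apply: leq_ltn_trans ik.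
Qed.

End FpsRing.

Section FpsUnit.
Variable R : comUnitRingType.
Implicit Types f g : fps R.

Definition fps_unit : pred (fps R) :=
  fun f => fps_coef f 0 \is a GRing.unit.

(* c^-1 * \sum_k (1 - f / c) ^+ k, where c is the constant coefficient of f;
   the terms with k > n do not contribute to the n-th coefficient. *)
Definition fps_inv f : fps R :=
  if fps_unit f then
    let c := fpsC (fps_coef f 0)^-1 in
    Fps (fun n => fps_coef (c * \sum_(k < n.+1) (1 - c * f) ^+ k) n)
  else f.

Fact fps_mulV : {in fps_unit, left_inverse 1 fps_inv *%R}.
Proof.
move=> f fU; have uf : fps_unit f := fU; rewrite /fps_inv uf.
set c := fpsC _; set w := 1 - c * f.
have w0 : fps_coef w 0 = 0.
  by rewrite -[LHS]/(1 - fps_coef (c * f) 0) fps_coefM0 /= mulVr // subrr.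
apply: fpsP => n; rewrite /=.
transitivity (fps_coef ((c * \sum_(k < n.+1) w ^+ k) * f) n).
  apply: eq_bigr => i _; congr (_ * _); apply: eq_bigr => j _; congr (_ * _).
  by apply: fps_coef_geom => //; rewrite leq_subr -ltnS ltn_ord.
rewrite mulrAC -[c * f](subKr 1) -/w -opprB mulNr -subrX1 opprB.
by rewrite -[LHS]/(fps_coef 1 n - _) fps_coefX_lt // subr0.
Qed.

Fact fps_unitP f g : g * f = 1 -> fps_unit f.
Proof.
move=> /(congr1 (fun h => fps_coef h 0)); rewrite fps_coefM0 /= => gf1.
by apply/unitrPr; exists (fps_coef g 0); rewrite mulrC.
Qed.

Fact fps_inv_out : {in [predC fps_unit], fps_inv =1 id}.
Proof.
move=> f fU; have /negPf nuf : ~~ fps_unit f := fU.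
by rewrite /fps_inv nuf.
Qed.

HB.instance Definition _ := GRing.ComNzRing_hasMulInverse.Build (fps R)
  fps_mulV fps_unitP fps_inv_out.

End FpsUnit.

(** * Power series in x, y, q, as Z[[q]][[y]][[x]] *)

Definition fps3 := fps (fps (fps int)).

Definition varx : fps3 := fpsX _.
Definition vary : fps3 := fpsC (fpsX _).
Definition varq : fps3 := fpsC (fpsC (fpsX _)).

Definition coef3 (F : fps3) (a b n : nat) : int :=
  fps_coef (fps_coef (fps_coef F a) b) n.

(* Coefficientwise sum of a (possibly infinite) family of power series in which
   each monomial occurs finitely often; [\sum_(i \in A)] is 0 at a coefficient
   where the family has infinite support. *)
Definition fps3_sum (I : choiceType) (A : set I) (F : I -> fps3) : fps3 :=
  Fps (fun a => Fps (fun b => Fps (fun n => \sum_(i \in A) coef3 (F i) a b n))).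

(** * Non-empty partitions *)

Record intpart := IntPart {
  parts :> seq nat;
  _ : [&& parts != [::], sorted geq parts & 0%N \notin parts] }.

HB.instance Definition _ := [isSub for parts].
HB.instance Definition _ := [Choice of intpart by <:].

Definition largest (p : intpart) : nat := head 0%N p.
Definition hook (p : intpart) : nat := (largest p + size p - 1)%N.

(* Out of range, [nth 0 p] is 0, so that [nth 0 p (size p)] is 0. *)
Definition frakG (d : nat) : set intpart := [set p : intpart |
  (forall i, (i < size p)%N ->
     nth 0%N p i = 1 %[mod 2 * d + 1] \/ nth 0%N p i = d + 2 %[mod 2 * d + 1])
  /\ (forall i, (i < size p)%N ->
     (nth 0 p i - nth 0 p i.+1 <= 2 * d + 1)%N
     /\ (nth 0%N p i = 1 %[mod 2 * d + 1] ->
         (nth 0 p i - nth 0 p i.+1 < 2 * d + 1)%N))].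

(* Since parts are listed in non-increasing order, the truncated subtraction
   below is the actual difference. *)
Definition parts_differ_by (d : nat) : set intpart := [set p : intpart |
  forall i j, (i < j < size p)%N -> (d <= nth 0 p i - nth 0 p j)%N].

Definition parts_1mod (m : nat) : set intpart := [set p : intpart |
  forall k, k \in parts p -> k = 1 %[mod m]].

Definition count_hook (A : set intpart) (n : nat) : nat :=
  #|` fset_set (A `&` [set p | hook p = n])|.

(* [fset_set] sends infinite sets to the empty one; here the set is finite. *)
Lemma finite_hook (n : nat) : finite_set [set p : intpart | hook p = n].
Proof.
pose f (s : n.-bseq 'I_n.+1) := map val (val s).
have -> : [set p : intpart | hook p = n]
    = [set p : intpart | hook p = n /\ exists s, f s = parts p].
  apply/seteqP; split=> [p /= pn|p []//]; split=> //.
  case: p pn => -[//|a s] /= pP; rewrite /hook /largest /= => hn.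
  have sz : (size (map (@inord n) (a :: s)) <= n)%N.
    have : (0 < a)%N by move: pP => /andP[_]; rewrite inE eq_sym negb_or lt0n => /andP[].
    by rewrite size_map /= -hn; case: a {pP hn} => // a _; rewrite addSn subn1 /= leq_addl.
  exists (Bseq sz); rewrite /f -map_comp -[RHS]map_id; apply/eq_in_map => b bs /=.
  apply: inordK; rewrite ltnS.
  have : (b <= a)%N.
    move: pP bs => /andP[/(order_path_min (rev_trans leq_trans)) /allP H _].
    by rewrite inE => /predU1P[->//|/H].
  by move=> /leq_trans; apply; rewrite -hn addnS subn1 /= leq_addr.
apply: (@sub_finite_set _ _ (parts @^-1` range f)).
  by move=> p [_ [s E]]; exists s.
apply: finite_preimage; first by move=> p p' _ _; apply: val_inj.
exact: finite_image.
Qed.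

Definition h_count (d : nat) : nat -> nat := count_hook (parts_differ_by d).
Definition f_count (d : nat) : nat -> nat := count_hook (parts_1mod (d + 1)).
Definition g_count (d : nat) : nat -> nat := count_hook (frakG d).

(* Main.v *)
(** Adjoin the value 0 after the last part of a partition. Each of the three
    classes then consists of the sequences all of whose consecutive entries are
    related by a fixed relation, so the number N(a, b) of its members with
    largest part a and b parts satisfies a transfer recurrence in b. Summing the
    recurrence gives binomial coefficients: with M = 2d + 1,
    - parts differing by at least d: N(a + 1, b + 1) = C(a + b - db, b);
    - parts congruent to 1 mod d + 1: N(k(d + 1) + 1, b + 1) = C(b + k, k);
    - G_d: N(kM + 1, b + 1) = C(b + k, 2k) and
      N(kM + d + 2, b + 1) = C(b + k + 1, 2k + 1).
    Summing over the a, b with a + b = m + 2 (so that the hook length is m + 1)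
    gives the sum of the C(m - dk, k) in all three cases. For G_d the recurrence
    also yields N(a, b + 2) - 2 N(a, b + 1) + N(a, b) = N(a - M, b + 1) away from
    the initial terms, which is the denominator of the generating function. *)

Require Import Defs.
From mathcomp Require Import all_boot all_order all_algebra.
From mathcomp Require Import all_classical.
From mathcomp Require Import finmap zify ring.

Set Implicit Arguments.
Unset Strict Implicit.
Unset Printing Implicit Defensive.

Import GRing.Theory.

(** * Partitions as chains of a relation *)

(** The empty sequence counts as having head 0, so the base case encodes the adjoined 0. Stopping
    the next entry at [a] loses nothing for a decreasing relation. *)
Fixpoint chains (R : rel nat) (b a : nat) : seq (seq nat) :=
  if b is b'.+1 then
    [seq a :: s | s <- flatten [seq chains R b' a' | a' <- iota 0 a.+1 & R a a']]
  else if a == 0 then [:: [::]] else [::].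

Lemma chainsS R b a : chains R b.+1 a =
  [seq a :: s | s <- flatten [seq chains R b a' | a' <- iota 0 a.+1 & R a a']].
Proof. by []. Qed.

Definition nchains R b a := size (chains R b a).

(** At the last index the default 0 of [nth] is the adjoined entry. *)
Definition is_chain (R : rel nat) (s : seq nat) :=
  forall i, i < size s -> R (nth 0 s i) (nth 0 s i.+1).

(** Positivity keeps 0 out of a chain, so that nonempty chains are partitions. *)
Definition decreasing_rel (R : rel nat) :=
  forall a a', R a a' -> (0 < a) && (a' <= a).

Lemma is_chain_cons R x s :
  is_chain R (x :: s) <-> R x (head 0 s) /\ is_chain R s.
Proof.
split=> [H|[H0 H] [|i] /= lti]; last exact: H.
  split; first by case: s H => [|y s] H; apply: (H 0).
  by move=> i lti; apply: (H i.+1).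
by case: s H0 {H lti}.
Qed.

Lemma mem_chains R b a s : decreasing_rel R ->
  s \in chains R b a <-> [/\ size s = b, head 0 s = a & is_chain R s].
Proof.
move=> Rdec; elim: b a s => [|b IH] a s.
  rewrite /=; case: eqVneq => [->|a0]; split.
  - by rewrite inE => /eqP ->.
  - by case=> /size0nil ->.
  - by [].
  - by case=> /size0nil -> /= /esym/eqP; rewrite (negPf a0).
rewrite chainsS; split=> [/mapP[t /flatten_mapP[a']]|].
  rewrite mem_filter => /andP[Raa' _] /IH[st ht ct] -> /=.
  by split; rewrite ?st //; apply/is_chain_cons; rewrite ht.
case: s => [|x s] [] // [sb] hx /is_chain_cons[].
rewrite (_ : x = a) // => Ras cs.
apply/map_f/flatten_mapP; exists (head 0 s); last exact/IH.
rewrite mem_filter Ras mem_iota /=.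
by have /andP[_] := Rdec _ _ Ras; rewrite add0n ltnS.
Qed.

Lemma chains_uniq R b a : decreasing_rel R -> uniq (chains R b a).
Proof.
move=> Rdec; elim: b a => [|b IH] a; first by rewrite /=; case: eqP.
rewrite chainsS map_inj_uniq => [|s t [] //].
have : uniq [seq a' <- iota 0 a.+1 | R a a'] by rewrite filter_uniq ?iota_uniq.
elim: [seq _ <- _ | _] => //= x r IHr /andP[xr ur].
rewrite cat_uniq IH IHr // andbT; apply/hasPn => s /flatten_mapP[y yr sy].
apply/negP => sx; move/mem_chains: sy => /(_ Rdec)[_ hy _].
by move/mem_chains: sx => /(_ Rdec)[_ hx _]; move: xr; rewrite -hx hy yr.
Qed.

Lemma nchains0 R a : nchains R 0 a = (a == 0).
Proof. by rewrite /nchains /=; case: eqP. Qed.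

Lemma nchainsS R b a :
  nchains R b.+1 a = \sum_(0 <= a' < a.+1) R a a' * nchains R b a'.
Proof.
rewrite /nchains chainsS size_map size_flatten /shape -map_comp sumnE.
rewrite big_map big_filter /index_iota subn0 big_mkcond.
by apply: eq_bigr => a' _; case: ifP; rewrite ?mul1n.
Qed.

Lemma nchainsS0 R b : decreasing_rel R -> nchains R b.+1 0 = 0.
Proof.
move=> Rdec; rewrite nchainsS big_nat1.
by case R0: (R 0 0) => //; have := Rdec _ _ R0.
Qed.

Lemma decreasing_chainP s :
  sorted geq s && (0 \notin s) <->
  is_chain (fun a a' => (0 < a) && (a' <= a)) s.
Proof.
elim: s => [|x s IH]; first by split.
rewrite is_chain_cons -IH inE negb_or eq_sym -lt0n.
case: s {IH} => [|y s] /=; first by rewrite leq0n !andbT; split=> [|[]].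
by split=> [/andP[/andP[-> ->] /andP[-> ->]]|[/andP[-> ->] /andP[-> ->]]].
Qed.

(** [insub] drops what is not a partition; for a decreasing relation and positive length nothing is
    dropped. *)
Definition partitions_of_chains R b a : seq intpart := pmap insub (chains R b a).

Definition chain_set (R : rel nat) : set intpart := fun p => is_chain R p.

Lemma mem_partitions_of_chains R b a p : decreasing_rel R ->
  p \in partitions_of_chains R b a <-> [/\ size p = b, largest p = a & chain_set R p].
Proof.
by move=> Rdec; rewrite mem_pmap_sub; apply: mem_chains.
Qed.

Lemma partitions_of_chains_uniq R b a :
  decreasing_rel R -> uniq (partitions_of_chains R b a).
Proof. by move=> Rdec; rewrite pmap_sub_uniq ?chains_uniq. Qed.

Lemma size_partitions_of_chains R b a : decreasing_rel R ->
  size (partitions_of_chains R b.+1 a) = nchains R b.+1 a.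
Proof.
move=> Rdec; rewrite size_pmap_sub /nchains.
apply/eqP; rewrite -all_count; apply/allP => s /mem_chains-/(_ Rdec)[sz _ cs].
case: s sz cs => // x s _ cs; rewrite -[_ != _]/true /=.
apply/decreasing_chainP => i lti; exact/Rdec/cs.
Qed.

(** With hook length [m.+1] and largest part [a.+1] there are [(m - a).+1] parts; distinct [a] give
    disjoint lists. *)
Lemma count_hook_chain_set R m : decreasing_rel R ->
  count_hook (chain_set R) m.+1 = \sum_(0 <= a < m.+1) nchains R (m - a).+1 a.+1.
Proof.
move=> Rdec.
pose P a := partitions_of_chains R (m - a).+1 a.+1.
have Puniq : uniq (flatten [seq P a | a <- iota 0 m.+1]).
  have : uniq (iota 0 m.+1) by apply: iota_uniq.
  elim: (iota 0 m.+1) => [|a r IHr] //= /andP[ar ur].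
  rewrite cat_uniq IHr // partitions_of_chains_uniq // andbT.
  apply/hasPn => p /flatten_mapP[a' a'r /mem_partitions_of_chains-/(_ Rdec)[_ la' _]].
  apply/negP => /mem_partitions_of_chains-/(_ Rdec)[_ la _].
  have aa' : a' = a by apply: succn_inj; rewrite -la' -la.
  by move: ar; rewrite -aa' a'r.
have memP p : p \in flatten [seq P a | a <- iota 0 m.+1] <->
    chain_set R p /\ hook p = m.+1.
  split=> [/flatten_mapP[a]|[cp hp]].
    rewrite mem_iota => am /mem_partitions_of_chains-/(_ Rdec)[sp lp cp].
    by split=> //; rewrite /hook sp lp; lia.
  have lp : 0 < largest p.
    case: (p) cp => -[|a s] //= pP cp; rewrite /largest /=.
    by have /andP[] := Rdec _ _ (cp 0 isT).
  have sp : 0 < size p by case: (p) => -[].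
  move: hp; rewrite /hook => hp; apply/flatten_mapP; exists (largest p).-1.
    by rewrite mem_iota; lia.
  by apply/mem_partitions_of_chains => //; split=> //; lia.
rewrite /count_hook.
have -> : (chain_set R `&` [set p : intpart | hook p = m.+1])%classic
    = [set` [fset p in flatten [seq P a | a <- iota 0 m.+1]]%fset]%classic.
  apply/seteqP; split=> p Hp; first by rewrite /mkset in_fset; apply/memP.
  by apply/memP; move: Hp; rewrite /mkset in_fset.
rewrite set_fsetK card_fseq undup_id // size_flatten /shape -map_comp sumnE big_map.
rewrite /index_iota subn0; apply: eq_bigr => a _.
exact: size_partitions_of_chains.
Qed.

Lemma fsum_chain_set R b a : decreasing_rel R ->
  (\sum_(p \in chain_set R) (((size p == b.+1) && (largest p == a))%:R : int)
    = (nchains R b.+1 a)%:R)%R.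
Proof.
move=> Rdec.
(* The sum reduces to a finite list, off which the summand vanishes. *)
rewrite -(fsbig_widen [set` partitions_of_chains R b.+1 a]).
- rewrite -fsbig_seq ?partitions_of_chains_uniq // -size_partitions_of_chains //.
  rewrite -sum1_size natr_sum big_seq [RHS]big_seq.
  apply: eq_bigr => p /mem_partitions_of_chains-/(_ Rdec)[-> -> _].
  by rewrite !eqxx.
- by move=> p /mem_partitions_of_chains-/(_ Rdec)[].
- move=> p [cp np]; rewrite /preimage /=; case: andP => // -[/eqP sp /eqP lp].
  by case: np; apply/mem_partitions_of_chains.
Qed.

(** * Counting the three classes by largest part and length *)

(** The disjunct [a' == 0] frees the last part from any gap to the adjoined 0. *)
Definition relH d : rel nat := fun a a' => (0 < a) && ((a' == 0) || (a' + d <= a)).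

Definition relF d : rel nat :=
  fun a a' => [&& 0 < a, a' <= a & a == 1 %[mod d + 1]].

Definition relG d : rel nat := fun a a' =>
  [&& 0 < a, a' <= a,
      (a == 1 %[mod 2 * d + 1]) || (a == d + 2 %[mod 2 * d + 1]),
      a - a' <= 2 * d + 1 &
      (a == 1 %[mod 2 * d + 1]) ==> (a - a' < 2 * d + 1)].

Lemma relH_decreasing d : decreasing_rel (relH d).
Proof. by move=> a a'; rewrite /relH; lia. Qed.

Lemma relF_decreasing d : decreasing_rel (relF d).
Proof. by move=> a a' /and3P[-> ->]. Qed.

Lemma relG_decreasing d : decreasing_rel (relG d).
Proof. by move=> a a' /and5P[-> ->]. Qed.

Lemma intpart_nth (p : intpart) i : i < size p ->
  (0 < nth 0 p i) && (nth 0 p i.+1 <= nth 0 p i).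
Proof. by move: i; apply/decreasing_chainP; case: p => s /= /andP[]. Qed.

Lemma intpart_nth_le (p : intpart) i j : i <= j < size p -> nth 0 p j <= nth 0 p i.
Proof.
move=> /andP[/subnKC <-]; elim: (j - i) => [|t IH]; rewrite ?addn0 // addnS => lt.
have lt' : i + t < size p by apply: ltnW.
by have /andP[_ /leq_trans] := intpart_nth lt'; apply; apply: IH.
Qed.

Lemma parts_differ_byE d : parts_differ_by d = chain_set (relH d).
Proof.
apply/seteqP; split=> p Hp => [i lti|i j /andP[ij jp]].
  have /andP[p0 ple] := intpart_nth lti; rewrite /relH p0 /=.
  case: (ltnP i.+1 (size p)) => [lti1|/(nth_default 0) -> //].
  by have := Hp i i.+1; rewrite ltnSn lti1 => /(_ isT); move: ple; lia.
(* Parts weakly decrease, so the gap after [i] bounds the gap from [i] to any later [j]. *)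
have lei : nth 0 p j <= nth 0 p i.+1 by apply: intpart_nth_le; rewrite ij.
have /andP[j0 _] := intpart_nth jp.
by move: (Hp i (ltn_trans ij jp)) j0 lei; rewrite /relH /=; lia.
Qed.

Lemma parts_1modE d : parts_1mod (d + 1) = chain_set (relF d).
Proof.
apply/seteqP; split=> p Hp => [i lti|_ /(nthP 0)[i lti <-]].
  have /andP[p0 ple] := intpart_nth lti.
  by rewrite /relF p0 ple; apply/eqP/Hp/mem_nth.
by have /and3P[_ _ /eqP] := Hp i lti.
Qed.

Lemma frakGE d : frakG d = chain_set (relG d).
Proof.
apply/seteqP; split=> p => [[Hmod Hgap] i lti|Hp].
  have /andP[p0 ple] := intpart_nth lti; have [gap gap1] := Hgap i lti.
  apply/and5P; split=> //; first by case: (Hmod i lti) => ->; rewrite eqxx ?orbT.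
  by apply/implyP => /eqP.
split=> i /Hp /and5P[_ _]; first by case/orP => /eqP; [left|right].
by move=> _ gap /implyP gap1; split=> // /eqP.
Qed.

(* The positivity of [a] excludes [k = -1] when [c = M]. *)
Lemma eqmodP M c a : 0 < c <= M -> 0 < a ->
  reflect (exists k, a = k * M + c) (a == c %[mod M]).
Proof.
move=> /andP[c0 cM] a0; apply: (iffP idP) => [|[k ->]]; last by rewrite modnMDl.
have [ca|ac] := leqP c a.
  rewrite eqn_mod_dvd // => /dvdnP[k E]; exists k.
  by rewrite -E subnK.
rewrite modn_small ?(leq_trans ac) //.
move: cM; rewrite leq_eqVlt => /orP[/eqP <-|cM].
  by rewrite modnn => /eqP a0'; rewrite a0' in a0.
by rewrite modn_small // => /eqP E; rewrite E ltnn in ac.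
Qed.

Lemma sum_indic c n (F : nat -> nat) :
  \sum_(0 <= i < n) (i == c) * F i = (c < n) * F c.
Proof.
elim: n => [|n IH]; first by rewrite big_geq.
rewrite big_nat_recr //= IH ltnS.
by case: ltngtP => [_|_|<-]; rewrite ?mul0n ?addn0.
Qed.

Section Counts.
Variable d : nat.
Hypothesis d_ge1 : 1 <= d.

Local Notation NH := (nchains (relH d)).
Local Notation NF := (nchains (relF d)).
Local Notation NG := (nchains (relG d)).

(** Each count is a partial sum of counts one part shorter, and partial sums of these binomials are
    again binomials by Pascal's rule ([psum]). *)
Lemma nchains_relH b a : NH b.+1 a.+1 = 'C(a + b - d * b, b).
Proof.
elim: b a => [|b IH] a.
  rewrite nchainsS bin0 big_nat_recl //= nchains0 /relH eqxx /= big1 ?addn0 // => i _.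
  by rewrite nchains0 /= muln0.
have psum t : \sum_(0 <= i < t.+1) NH b.+1 i = 'C(t + b - d * b, b.+1).
  elim: t => [|t IHt].
    rewrite big_nat1 nchainsS0; last exact: relH_decreasing.
    rewrite bin_small //; nia.
  rewrite big_nat_recr // IHt IH /=; have [le|lt] := leqP (d * b) (t + b).
    by rewrite addSn subSn // binS.
  have b0 : 0 < b by case: (b) lt => //; lia.
  by rewrite !bin_small //; lia.
rewrite nchainsS.
(* The count at [i = 0] is 0, so only the gap condition matters. *)
transitivity (\sum_(0 <= i < a.+2) (i < a.+2 - d) * NH b.+1 i).
  apply: eq_bigr => -[|i] _; first by rewrite nchainsS0 ?muln0 //; apply: relH_decreasing.
  by congr (_ * _); rewrite /relH; lia.
have [da|ad] := leqP d a.+1; last first.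
  rewrite big1; last by move=> i _; rewrite (_ : i < _ = false) //; lia.
  rewrite bin_small //; nia.
rewrite (@big_cat_nat _ _ _ (a.+2 - d)) //=; last by lia.
rewrite [X in _ + X]big_nat [X in _ + X]big1 ?addn0 => [|i /andP[le _]]; last first.
  by rewrite ltnNge le.
rewrite subSn // -[RHS](_ : 'C(a.+1 - d + b - d * b, b.+1) = _); last first.
  by congr ('C(_,_)); rewrite mulnS; lia.
by rewrite -psum; apply: eq_big_nat => i /andP[_ ->]; rewrite mul1n.
Qed.

Lemma nchains_relF_out b a : ~~ (d + 1 %| a) -> NF b.+1 a.+1 = 0.
Proof.
move=> nd; rewrite nchainsS big1 // => i _.
by rewrite /relF eqn_mod_dvd // subn1 (negPf nd) !andbF.
Qed.

(** Raising [k] by one adds a single nonzero term to the sum over the next part, so the inner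
    induction on [k] is Pascal's rule. *)
Lemma nchains_relF b k : NF b.+1 (k * (d + 1)).+1 = 'C(b + k, k).
Proof.
have R_in i k' : relF d (k' * (d + 1)).+1 i = (i <= (k' * (d + 1)).+1).
  by rewrite /relF eqn_mod_dvd // subn1 /= dvdn_mull // andbT.
elim: b k => [|b IH] k.
  rewrite nchainsS binn big_nat_recl //= nchains0 R_in /= big1 ?addn0 // => i _.
  by rewrite nchains0 /= muln0.
have NS k' : NF b.+2 (k' * (d + 1)).+1 =
    \sum_(0 <= i < (k' * (d + 1)).+2) NF b.+1 i.
  by rewrite nchainsS; apply: eq_big_nat => i /andP[_ lt]; rewrite R_in -ltnS lt mul1n.
elim: k => [|k IHk].
  rewrite NS mul0n big_nat_recl // big_nat1 nchainsS0; last exact: relF_decreasing.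
  by have := IH 0; rewrite mul0n => ->; rewrite !bin0.
rewrite NS (@big_cat_nat _ _ _ (k * (d + 1)).+2) //=; last by rewrite mulSn; lia.
rewrite -NS IHk big_nat_recr /=; last by rewrite mulSn; lia.
rewrite big_nat big1 => [|[//|i] /andP[lo hi]]; last first.
  apply: nchains_relF_out; apply/negP => /dvdnP[q E]; move: lo hi; rewrite E !ltnS.
  by rewrite ltn_mul2r ltn_mul2r => /andP[_ kq] /andP[_]; rewrite ltnS leqNgt kq.
by rewrite add0n IH addSn !addnS binS addSn addnC.
Qed.

Let M := 2 * d + 1.

Lemma relG_class a a' : relG d a a' ->
  (exists k, a = k * M + 1) \/ (exists k, a = k * M + (d + 2)).
Proof.
case/and5P=> a0 _ /orP[] /eqmodP H _ _; [left|right]; apply: H => //; lia.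
Qed.

Lemma relG1 k a' : relG d (k * M + 1) a' = (a' <= k * M + 1) && (k * M + 1 - a' < M).
Proof.
rewrite /relG -/M modnMDl eqxx /=; lia.
Qed.

Lemma relG2 k a' : relG d (k * M + (d + 2)) a' =
  (a' <= k * M + (d + 2)) && (k * M + (d + 2) - a' <= M).
Proof.
(* Since [0 < d + 1 < M], the two residues differ and the strict gap condition does not apply. *)
have n1 : (d + 2 == 1 %[mod M]) = false.
  by rewrite eqn_mod_dvd ?gtnNdvd // /M; lia.
rewrite /relG -/M !modnMDl eqxx n1 /=; lia.
Qed.

(** Locates the support of the counts, so that the sums below collapse to a few terms. *)
Lemma nchains_relG_class b a : NG b a <> 0 ->
  a = 0 \/ (exists k, a = k * M + 1) \/ (exists k, a = k * M + (d + 2)).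
Proof.
case: b => [|b]; first by rewrite nchains0; case: eqP => [->|]; [left|].
rewrite nchainsS => N0; right.
have [[i Ri]|nR] := pselect (exists i, relG d a i); first exact: relG_class Ri.
case: N0; rewrite big1 // => i _; case Ri: (relG d a i) => //; case: nR; by exists i.
Qed.

(** Makes the comparison of [k] with [k'] linear in the products; [k = k' + 1] stands apart as the
    only lower period within reach of a gap. *)
Let mulM_cmp k k' : [\/ k * M + M <= k' * M, k * M = k' * M,
  k * M = k' * M + M | k' * M + M + M <= k * M].
Proof.
case: (ltngtP k k') => [lt|gt|->]; last by constructor 2.
  by constructor 1; rewrite -mulSnr leq_mul.
case: (ltngtP k k'.+1) => [lt|gt'|->].
- by move: lt; rewrite ltnS leqNgt gt.
- by constructor 4; rewrite -!mulSnr leq_mul.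
- by constructor 3; rewrite mulSnr.
Qed.

(* For [k = 0] the truncated subtraction [1 - d] is 0, the entry after the last part. *)
Lemma nchains_relG1S b k :
  NG b.+1 (k * M + 1) = NG b (k * M + 1) + NG b (k * M + 1 - d).
Proof.
rewrite nchainsS.
transitivity (\sum_(0 <= i < (k * M + 1).+1)
    ((i == k * M + 1) * NG b i + (i == k * M + 1 - d) * NG b i)).
  (* A gap below [M] reaches only these two supported entries: the class of 1 one period lower lies
     at gap exactly [M]. *)
  apply: eq_big_nat => i /andP[_ lti]; rewrite -mulnDl.
  have [->|/eqP/nchains_relG_class cl] := eqVneq (NG b i) 0; first by rewrite !muln0.
  congr (_ * _); rewrite relG1.
  case: cl => [->|[[k']|[k']] ->]; first by case: (k) => [|?]; rewrite ?mulSn /M; lia.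
    by case: (mulM_cmp k k'); rewrite /M; lia.
  by case: (mulM_cmp k k'); rewrite /M; lia.
rewrite big_split !sum_indic; congr (_ + _).
  by rewrite ltnSn mul1n.
by rewrite ltnS leq_subr mul1n.
Qed.

(** Gaps up to [M] reach the entry itself, the class of 1 at distance [d + 1], and the same class at
    distance [M], which for [k = 0] is replaced by the adjoined 0. *)
Lemma nchains_relG2S b k : NG b.+1 (k * M + (d + 2)) =
  NG b (k * M + (d + 2)) + NG b (k * M + 1) + NG b (k * M + (d + 2) - M).
Proof.
rewrite nchainsS.
transitivity (\sum_(0 <= i < (k * M + (d + 2)).+1)
    ((i == k * M + (d + 2)) * NG b i + (i == k * M + 1) * NG b i
     + (i == k * M + (d + 2) - M) * NG b i)).
  apply: eq_big_nat => i /andP[_ lti]; rewrite -!mulnDl.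
  have [->|/eqP/nchains_relG_class cl] := eqVneq (NG b i) 0; first by rewrite !muln0.
  congr (_ * _); rewrite relG2.
  case: cl => [->|[[k']|[k']] ->]; first by case: (k) => [|?]; rewrite ?mulSn /M; lia.
    by case: (mulM_cmp k k'); rewrite /M; lia.
  by case: (mulM_cmp k k'); rewrite /M; lia.
rewrite !big_split !sum_indic; congr (_ + _ + _).
- by rewrite ltnSn mul1n.
- by rewrite (_ : _ < _) ?mul1n //; lia.
- by rewrite ltnS leq_subr mul1n.
Qed.

(** The classes feed each other, hence the joint induction; the first recurrence is Pascal's rule
    once, the second twice. *)
Lemma nchains_relG b k :
  NG b.+1 (k * M + 1) = 'C(b + k, k.*2) /\
  NG b.+1 (k * M + (d + 2)) = 'C(b + k.+1, k.*2.+1).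
Proof.
elim: b k => [|b IH] k.
  rewrite nchains_relG1S nchains_relG2S !nchains0.
  case: k => [|k]; last by rewrite !bin_small ?mulSn /M; lia.
  by rewrite !mul0n !add0n /M bin0 bin1; lia.
rewrite nchains_relG1S nchains_relG2S; case: (IH k) => -> ->; split.
  case: k => [|k].
    rewrite (_ : 0 * M + 1 - d = 0); last lia.
    by rewrite nchainsS0 ?addn0 ?bin0 //; apply: relG_decreasing.
  rewrite (_ : k.+1 * M + 1 - d = k * M + (d + 2)); last by rewrite /M mulSn; lia.
  by case: (IH k) => _ ->; rewrite doubleS !addSn binS addnS.
case: k => [|k].
  rewrite (_ : 0 * M + (d + 2) - M = 0); last by rewrite /M; lia.
  rewrite nchainsS0 ?addn0 //; last exact: relG_decreasing.
  by rewrite addnS addn0 bin1 bin0 bin1 addn1.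
rewrite (_ : k.+1 * M + (d + 2) - M = k * M + (d + 2)); last by rewrite mulSn; lia.
case: (IH k) => _ ->; rewrite doubleS addSn (binS _ k.*2.+2) -addnA; congr (_ + _).
by rewrite !addnS binS.
Qed.
End Counts.

(** * Counting by hook length *)

(** With [b = m - a] and [a = d * k + c k], one has [b + c k = m - d * k]. Applied to [relF] with
    [c = id] and to [relG] with [c = uphalf]. *)
Lemma sum_antidiag d (c : nat -> nat) (w : nat -> nat -> nat) m :
  0 < d -> (forall k, c k <= k) -> {homo c : k l / k <= l} ->
  (forall b k, w b (d * k + c k) = 'C(b + c k, k)) ->
  (forall b a, w b a <> 0 -> exists k, a = d * k + c k) ->
  \sum_(0 <= a < m.+1) w (m - a) a = \sum_(0 <= k < m.+1) 'C(m - d * k, k).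
Proof.
move=> d0 c_le c_homo wC w_supp; pose al k := d * k + c k.
(* Strict monotonicity makes [k] unique for given [a], so [w] can be written as a delta sum and the
   summations exchanged. *)
have al_mono k l : k < l -> al k < al l.
  by move=> kl; rewrite /al -addSn leq_add ?ltn_pmul2l // c_homo // ltnW.
have al_inj k l : (al k == al l) = (k == l).
  by case: (ltngtP k l) => [/al_mono|/al_mono|->]; rewrite ?eqxx //; case: ltngtP.
transitivity (\sum_(0 <= a < m.+1) \sum_(0 <= k < m.+1) (a == al k) * w (m - a) a).
  apply: eq_big_nat => a /andP[_ am].
  have [->|/eqP/w_supp[k ak]] := eqVneq (w (m - a) a) 0.
    by rewrite big1 // => k _; rewrite muln0.
  have km : k < m.+1.
    by apply: leq_ltn_trans am; rewrite ak (leq_trans _ (leq_addr _ _)) // leq_pmull.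
  under eq_bigr => l _ do rewrite [a in a == _]ak al_inj eq_sym.
  by rewrite (sum_indic _ _ (fun=> _)) km mul1n.
rewrite exchange_big; apply: eq_big_nat => k /andP[_ km] /=.
rewrite (sum_indic _ _ (fun a => w (m - a) a)) wC /al ltnS.
case: leqP => [le|lt]; rewrite ?mul1n ?mul0n; first by congr 'C(_, _); lia.
(* Here [m < d * k + c k]. This is impossible for [k = 0], as [c 0 = 0]; otherwise [m - d * k < k]
   and the binomial vanishes. *)
case: k lt {km} => [|k]; first by have := c_le 0; rewrite muln0; lia.
by move=> lt; rewrite bin_small //; have := c_le k.+1; lia.
Qed.

Section HookCounts.
Variables d m : nat.
Hypothesis d_ge1 : 1 <= d.

(** After reversal of the sum, [k] is the number of parts minus one. *)
Lemma h_countE : h_count d m.+1 = \sum_(0 <= k < m.+1) 'C(m - d * k, k).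
Proof.
rewrite /h_count parts_differ_byE count_hook_chain_set; last exact: relH_decreasing.
rewrite big_nat_rev /=; apply: eq_big_nat => k /andP[_ km].
rewrite add0n subSS subKn // nchains_relH //; congr 'C(_, _); lia.
Qed.

Lemma f_countE : f_count d m.+1 = \sum_(0 <= k < m.+1) 'C(m - d * k, k).
Proof.
rewrite /f_count parts_1modE count_hook_chain_set; last exact: relF_decreasing.
apply: (@sum_antidiag d id (fun b a => nchains (relF d) b.+1 a.+1)) => // [b k|b a].
  by rewrite /= (_ : d * k + k = k * (d + 1)) ?nchains_relF // mulnDr muln1 mulnC.
have [/dvdnP[k ->] _|/nchains_relF_out -> //] := boolP (d + 1 %| a).
by exists k; rewrite mulnDr muln1 mulnC.
Qed.

(* [d * j + uphalf j] runs through [k * M] and [k * M + d + 1] for j = 2k, 2k + 1. *)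
Lemma g_countE : g_count d m.+1 = \sum_(0 <= k < m.+1) 'C(m - d * k, k).
Proof.
rewrite /g_count frakGE count_hook_chain_set; last exact: relG_decreasing.
apply: (@sum_antidiag d uphalf (fun b a => nchains (relG d) b.+1 a.+1)) => //.
- by move=> k; rewrite uphalf_half; have := odd_double_half k; lia.
- move=> k l kl; rewrite !uphalf_half.
  by have := odd_double_half k; have := odd_double_half l; lia.
- move=> b j; have [N1 N2] := nchains_relG d_ge1 b j./2.
  rewrite -(odd_double_half j) in N1 N2 *; move: N1 N2.
  rewrite half_bit_double; move: j./2 => k; case: (odd j) => N1 N2.
    rewrite add1n /= doubleK in N2 *; rewrite -N2; congr (nchains _ _ _); nia.
  rewrite add0n uphalf_double -N1; congr (nchains _ _ _); nia.
- move=> b a /(nchains_relG_class d_ge1) [//|[] [k E]].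
    by exists k.*2; rewrite uphalf_double; nia.
  by exists k.*2.+1; rewrite /= doubleK; nia.
Qed.
End HookCounts.

(** * The generating function *)

Section Recurrence.
Variable d : nat.
Hypothesis d_ge1 : 1 <= d.
Local Notation NG := (nchains (relG d)).
Let M := 2 * d + 1.

(** Provides the numerator terms linear in y; the binomials vanish for [k > 0]. *)
Lemma nchains_relG_length1 a : NG 1 a = (a == 1) + (a == d + 2).
Proof.
have [E|/eqP/(nchains_relG_class d_ge1)[->|[[k ->]|[k ->]]]] := eqVneq (NG 1 a) 0.
- have [H1 H2] := nchains_relG d_ge1 0 0; move: E H1 H2.
  rewrite !mul0n !add0n bin0 bin1 => E N1 N2.
  have a1 : a == 1 = false by apply/eqP => a1; rewrite a1 N1 in E.
  have a2 : a == d + 2 = false by apply/eqP => a2; rewrite a2 N2 in E.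
  by rewrite E a1 a2.
- by rewrite nchainsS0 ?addn2 //; apply: relG_decreasing.
- have [-> _] := nchains_relG d_ge1 0 k; case: k => [|k].
    by rewrite mul0n bin0; lia.
  by rewrite bin_small ?mulSn; lia.
- have [_ ->] := nchains_relG d_ge1 0 k; case: k => [|k].
    by rewrite mul0n bin1; lia.
  by rewrite bin_small ?mulSn; lia.
Qed.

(** Differencing in the length turns the class of [d + 2] into the class of 1 at the same [k]
    ([step]), and the class of 1 into the class of [d + 2] one period lower; two differences thus
    shift by [M]. The correction at [a = 1], [b = 0] comes from the empty chain. *)
Lemma nchains_relG_recurrence a b : 0 < a ->
  NG b.+2 a + NG b a + ((a == 1) && (b == 0)) =
  2 * NG b.+1 a + (if M <= a then NG b.+1 (a - M) else 0).
Proof.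
move=> a0.
have N0 b' : NG b'.+1 0 = 0 by apply/nchainsS0/relG_decreasing.
have N00 b' : NG b' 0 = (b' == 0) by case: b' => // b'; rewrite N0.
have step k b' : NG b'.+1 (k * M + (d + 2)) = NG b' (k * M + (d + 2)) + NG b'.+1 (k * M + 1).
  rewrite (nchains_relG2S d_ge1) (nchains_relG1S d_ge1) -/M -addnA; congr (_ + (_ + NG _ _)).
  by rewrite /M; lia.
have [[k ak]|n1] := pselect (exists k, a = k * M + 1).
  rewrite {a a0}ak; rewrite !(nchains_relG1S d_ge1) -/M; case: k => [|k].
    rewrite (_ : 0 * M + 1 - d = 0) ?N0; last lia.
    rewrite N00 (_ : M <= 0 * M + 1 = false); last by rewrite /M; lia.
    by rewrite mul0n; lia.
  rewrite (_ : k.+1 * M + 1 - d = k * M + (d + 2)); last by rewrite mulSn /M; lia.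
  rewrite step (_ : M <= k.+1 * M + 1); last by rewrite mulSn; lia.
  rewrite (_ : k.+1 * M + 1 - M = k * M + 1); last by rewrite mulSn; lia.
  by rewrite (_ : k.+1 * M + 1 == 1 = false); rewrite ?mulSn /M; lia.
have [[k ak]|n2] := pselect (exists k, a = k * M + (d + 2)).
  rewrite {a a0 n1}ak !step !(nchains_relG1S d_ge1) -/M.
  case: k => [|k].
    rewrite (_ : 0 * M + 1 - d = 0) ?N0; last lia.
    rewrite (_ : 0 * M + (d + 2) - M = 0) ?N0; last by rewrite /M; lia.
    by rewrite mul0n; case: ifP; lia.
  rewrite (_ : k.+1 * M + 1 - d = k * M + (d + 2)); last by rewrite mulSn /M; lia.
  rewrite (_ : M <= k.+1 * M + (d + 2)); last by rewrite mulSn; lia.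
  rewrite (_ : k.+1 * M + (d + 2) - M = k * M + (d + 2)); last by rewrite mulSn; lia.
  by rewrite (_ : k.+1 * M + (d + 2) == 1 = false); rewrite ?mulSn /M; lia.
have out b' : NG b' a = 0.
  apply/eqP/contraT => /eqP/(nchains_relG_class d_ge1)[a00|[|] //].
  by rewrite a00 in a0.
have -> : (a == 1) = false by apply/eqP => a1; apply: n1; exists 0; rewrite a1.
rewrite !out; case: leqP => // Ma.
(* If [a - M] lay in one of the classes, so would [a]. *)
have [-> //|/eqP nz] := eqVneq (NG b.+1 (a - M)) 0.
case: (nchains_relG_class d_ge1 nz) => [aM|[|] [k E]].
- by case: nz; rewrite aM.
- by case: n1; exists k.+1; rewrite mulSn -addnA -E subnKC.
- by case: n2; exists k.+1; rewrite mulSn -addnA -E subnKC.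
Qed.
End Recurrence.

(** * Coefficients of products with monomials *)

Local Open Scope ring_scope.

Lemma fps_coef0 (R : comNzRingType) n : fps_coef (0 : fps R) n = 0.
Proof. by case: n. Qed.

Lemma fps_coefCM (R : comNzRingType) (c : R) f n :
  fps_coef (fpsC c * f) n = c * fps_coef f n.
Proof.
by rewrite /= big_ord_recl /= subn0 big1 ?addr0 // => i _; rewrite mul0r.
Qed.

Lemma fps_coefXM (R : comNzRingType) k (f : fps R) n :
  fps_coef (fpsX R ^+ k * f) n = if (k <= n)%N then fps_coef f (n - k) else 0.
Proof.
elim: k n => [|k IH] n; first by rewrite expr0 mul1r subn0.
rewrite exprS -mulrA; set g := _ * f in IH *.
case: n => [|n]; first by rewrite fps_coefM0 mul0r.
rewrite ltnS subSS -IH [LHS]big_ord_recl big_ord_recl mul0r add0r mul1r.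
by rewrite big1 ?addr0 ?subSS ?subn0 // => i _; rewrite mul0r.
Qed.

Lemma fpsCX (R : comNzRingType) (c : R) k : fpsC c ^+ k = fpsC (c ^+ k).
Proof.
elim: k => [|k IH]; first by [].
apply: fpsP => n; rewrite exprS IH fps_coefCM; case: n => [|n] /=; first by rewrite exprS.
by rewrite mulr0.
Qed.

Definition mono3 i j k : fps3 := varx ^+ i * vary ^+ j * varq ^+ k.

Lemma coef3_mono3M i j k F a b n : coef3 (mono3 i j k * F) a b n =
  if [&& i <= a, j <= b & k <= n]%N then coef3 F (a - i) (b - j) (n - k) else 0.
Proof.
rewrite /mono3 /varx /vary /varq !fpsCX -!mulrA /coef3 fps_coefXM.
case: (i <= a)%N; last by rewrite !fps_coef0.
lazy beta iota delta [andb]; rewrite fps_coefCM fps_coefXM.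
case: (j <= b)%N; last by rewrite fps_coef0.
by lazy iota; rewrite !fps_coefCM fps_coefXM.
Qed.

Lemma coef3_mono3 i j k a b n :
  coef3 (mono3 i j k) a b n = [&& a == i, b == j & n == k]%:R.
Proof.
rewrite -[mono3 _ _ _]mulr1 coef3_mono3M.
have -> a' b' n' : coef3 1 a' b' n' = [&& a' == 0, b' == 0 & n' == 0]%N%:R.
  by case: a' b' n' => [|?] [|?] [|?].
case: ifP => [|H]; first by move=> /and3P[? ? ?]; congr (nat_of_bool _)%:R; lia.
by rewrite (_ : [&& _, _ & _] = false) //; lia.
Qed.

Lemma coef3P F G : (forall a b n, coef3 F a b n = coef3 G a b n) -> F = G.
Proof. by move=> E; apply: fpsP => a; apply: fpsP => b; apply: fpsP => n; apply: E. Qed.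

Lemma mono3E i j k : mono3 i j k = varx ^+ i * vary ^+ j * varq ^+ k.
Proof. by []. Qed.

(* Otherwise unification unfolds products of power series down to coefficients. *)
#[local] Opaque mono3.

(** Has the shape of the denominator, with [2yq] as a repeated term; taking coefficients as
    equations lets one rewrite compute them all. *)
Lemma coef3_comb F1 F2 F3 F4 a b n c1 c2 c3 c4 :
  coef3 F1 a b n = c1 -> coef3 F2 a b n = c2 ->
  coef3 F3 a b n = c3 -> coef3 F4 a b n = c4 ->
  coef3 (F1 - F2 - F2 + F3 - F4) a b n = c1 - c2 - c2 + c3 - c4.
Proof. by move=> <- <- <- <-. Qed.

Section GeneratingFunction.
Variable d : nat.
Hypothesis d_ge1 : (1 <= d)%N.

Let S := fps3_sum (frakG d)
  (fun p : intpart => varx ^+ largest p * vary ^+ size p * varq ^+ hook p).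

(** Largest part and size determine the hook length, so each coefficient is a chain count or 0. *)
Lemma coef3_frakG a b n : coef3 S a b n =
  Posz (if (0 < a)%N && (a + b == n.+1)%N then nchains (relG d) b a else 0).
Proof.
have -> : coef3 S a b n = \sum_(p \in frakG d)
    ([&& a == largest p, b == size p & n == hook p]%:R : int).
  rewrite /S /coef3 /=; apply: eq_fsbigr => p _.
  exact: (coef3_mono3 (largest p) (size p) (hook p) a b n).
have gt0 p : (0 < size (parts p))%N by case: p => -[].
have largest_gt0 p : (0 < largest p)%N.
  by have /andP[] := intpart_nth (gt0 p); rewrite nth0.
case: ifP => H; last first.
  rewrite fsbig1 // => p _; case: and3P => // -[/eqP ap /eqP bp /eqP np].
  by move: H (gt0 p) (largest_gt0 p); rewrite ap bp np /hook; lia.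
case: b H => [|b] H.
  rewrite nchains0 (_ : (a == 0)%N = false); last by lia.
  rewrite fsbig1 // => p _; have := gt0 p.
  by case: and3P => // -[_ /eqP <-].
rewrite -natz -fsum_chain_set; last exact: relG_decreasing.
rewrite -frakGE; apply: eq_fsbigr => p _; congr (nat_of_bool _)%:R.
rewrite /hook; lia.
Qed.

(** Lengths 0 and 1 give the initial terms; longer ones are the recurrence, whose correction is the
    numerator term in [y^2]. *)
Lemma frakG_denominator (F : fps3) :
  (forall a b n, coef3 F a b n =
    Posz (if (0 < a)%N && (a + b == n.+1)%N then nchains (relG d) b a else 0)) ->
  F * (mono3 0 0 0 - mono3 0 1 1 - mono3 0 1 1 + mono3 0 2 2
    - mono3 (2 * d + 1) 1 (2 * d + 2)) =
  mono3 1 1 1 - mono3 1 2 2 + mono3 (d + 2) 1 (d + 2).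
Proof.
move=> coefF; apply: coef3P => a b n; rewrite mulrC !mulrDl !mulNr.
have coef_rhs F1 F2 F3 c1 c2 c3 : coef3 F1 a b n = c1 ->
    coef3 F2 a b n = c2 -> coef3 F3 a b n = c3 ->
    coef3 (F1 - F2 + F3) a b n = c1 - c2 + c3 by move=> <- <- <-.
rewrite (coef_rhs _ _ _ _ _ _ (coef3_mono3 _ _ _ _ _ _) (coef3_mono3 _ _ _ _ _ _)
  (coef3_mono3 _ _ _ _ _ _)).
rewrite (coef3_comb (coef3_mono3M _ _ _ _ _ _ _)
  (coef3_mono3M _ _ _ _ _ _ _) (coef3_mono3M _ _ _ _ _ _ _) (coef3_mono3M _ _ _ _ _ _ _)).
rewrite !coefF {coefF coef_rhs} !subn0 /=.
rewrite !natz; have N0 c : nchains (relG d) c.+1 0 = 0%N.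
  exact/nchainsS0/relG_decreasing.
have [->|a0] := posnP a.
  rewrite !sub0n /=. rewrite !if_same; lia.
case: b => [|[|b]].
- by rewrite nchains0 /= !andbF /= ; case: ifP; lia.
- rewrite subnn /= !nchains0 (nchains_relG_length1 d_ge1); move: a0.
  repeat case: ifP; lia.
have := nchains_relG_recurrence d_ge1 b a0.
have ifE c1 c2 c t : c1 && c2 = c ->
    (if c1 then Posz (if c2 then t else 0) else 0) = Posz (c * t).
  by move=> <-; case: c1 => //; case: c2; rewrite /= ?mul1n.
(* The support condition on [F] makes the bound strict; the two agree since no nonempty chain starts
   at 0. *)
have ify : (if 2 * d + 1 <= a then nchains (relG d) b.+1 (a - (2 * d + 1)) else 0)%N
    = ((2 * d + 1 < a)%N * nchains (relG d) b.+1 (a - (2 * d + 1)))%N.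
  by case: ltngtP => [|_|<-] //; rewrite ?mul1n // subnn N0.
rewrite ify !subSS !subn0 {ify N0}.
rewrite (ifE _ _ (a + b.+1 == n)%N) //=; last by lia.
rewrite (ifE _ _ (a + b.+1 == n)%N) //=; last by lia.
rewrite (ifE _ _ ((2 * d + 1 < a) && (a + b.+1 == n))%N) //=; last by lia.
move: (nchains _ b.+1 (a - _)) (nchains _ b.+2 _) (nchains _ b.+1 _) (nchains _ b _).
move=> y x u z rec.
have [<-|ne] := eqVneq (a + b.+1)%N n; last first.
  by rewrite !andbF !mul0n ifF; lia.
rewrite !andbT !mul1n addnS eqxx; case: (_ < a)%N rec; rewrite ?mul1n ?mul0n; lia.
Qed.
End GeneratingFunction.

Lemma fps_unitE (R : comUnitRingType) (f : fps R) :
  (f \is a GRing.unit) = (fps_coef f 0 \is a GRing.unit).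
Proof. by []. Qed.

(** Invertibility is tested on constant coefficients, down through the three nested rings. *)
Lemma fps3_unit (F : fps3) : coef3 F 0 0 0 = 1 -> F \is a GRing.unit.
Proof. by move=> F1; rewrite !fps_unitE -/(coef3 F 0 0 0) F1 unitr1. Qed.

(** Reaches the shape of [mono3] over an arbitrary ring, where [ring] meets only variables. *)
Lemma denominator_expand (R : comNzRingType) (x y q : R) d :
  1 - 2 * y * q + y ^+ 2 * q ^+ 2 - x ^+ (2 * d + 1) * y * q ^+ (2 * d + 2) =
  x ^+ 0 * y ^+ 0 * q ^+ 0 - x ^+ 0 * y ^+ 1 * q ^+ 1 - x ^+ 0 * y ^+ 1 * q ^+ 1
  + x ^+ 0 * y ^+ 2 * q ^+ 2 - x ^+ (2 * d + 1) * y ^+ 1 * q ^+ (2 * d + 2).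
Proof. by move: (x ^+ (2 * d + 1)) (q ^+ (2 * d + 2)) => u v; ring. Qed.

Lemma numerator_expand (R : comNzRingType) (x y q : R) d :
  x * y * q * (1 - y * q + x ^+ (d + 1) * q ^+ (d + 1)) =
  x ^+ 1 * y ^+ 1 * q ^+ 1 - x ^+ 1 * y ^+ 2 * q ^+ 2
  + x ^+ (d + 2) * y ^+ 1 * q ^+ (d + 2).
Proof. by rewrite addn2 addn1 !(exprS _ d.+1); ring. Qed.

Theorem theorem2p17 (d : nat) (d_ge1 : (1 <= d)%N) :
  fps3_sum (frakG d)
    (fun p : intpart => varx ^+ largest p * vary ^+ size p * varq ^+ hook p)
  = varx * vary * varq
      * (1 - vary * varq + varx ^+ (d + 1) * varq ^+ (d + 1))
    / (1 - 2 * vary * varq + vary ^+ 2 * varq ^+ 2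
       - varx ^+ (2 * d + 1) * vary * varq ^+ (2 * d + 2))
  /\ (forall n : nat, (1 <= n)%N ->
        h_count d n = f_count d n /\ f_count d n = g_count d n).
Proof.
split; last by case=> // m _; rewrite h_countE ?f_countE ?g_countE.
set D := (X in _ / X); set S := fps3_sum _ _.
pose D' := mono3 0 0 0 - mono3 0 1 1 - mono3 0 1 1 + mono3 0 2 2
    - mono3 (2 * d + 1) 1 (2 * d + 2).
have DE : D = D' by rewrite /D /D' !mono3E; apply: denominator_expand.
have DU : D \is a GRing.unit.
  (* Every denominator monomial except the first contains y. *)
  have mono0 i j k : coef3 (mono3 i j.+1 k) 0 0 0 = 0.
    by rewrite coef3_mono3 /= andbF.
  apply: fps3_unit; rewrite DE (coef3_comb (coef3_mono3 _ _ _ _ _ _)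
    (mono0 _ _ _) (mono0 _ _ _) (mono0 _ _ _)).
  by rewrite !subr0.
(* Multiplying and dividing by the unit [D] leaves the product formula. *)
rewrite -[LHS](mulrK DU) DE (frakG_denominator d_ge1 (coef3_frakG d_ge1)) -DE.
by congr (_ / _); rewrite !mono3E -numerator_expand.
Qed.
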